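(* Let $k,r\ge 1$ be integers, $p\in(0,1)$, $q=1-p$. Let $Y$ be the waiting time for the $r$-th nonoverlapping success run of length $k$ (negative binomial distribution $\mathrm{NB}_{k,r}$ of Type I), and let $Z=Y-rk$. For $1\le j\le k$ put $$C_j=\frac{j!}{q^jp^k}\left[p^{j-1}(1-p^k)-p^k\sum_{i=1}^{j-1}\binom{k}{i}p^{j-i-1}q^i\right]-(k)_j .$$ Then for every integer $n\ge 1$ the factorial moment $M_{(n)}=\mathbb{E}[(Z)_n]$ is $$M_{(n)}=n!\sum_{n_1+2n_2+\dots+kn_k=n}(r+s_n-1)_{s_n}\prod_{j=1}^k\frac{1}{n_j!}\left(\frac{C_j}{j!}\right)^{n_j},$$ where the sum is over all $k$-tuples $(n_1,\dots,n_k)$ of nonnegative integers with $n_1+2n_2+\dots+kn_k=n$, and $s_n=n_1+\dots+n_k$.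
   Context: Consider independent Bernoulli trials, indexed $1,2,3,\dots$, each with success probability $p$. Success runs of length $k$ are counted in the nonoverlapping sense: as soon as $k$ consecutive successes are attained, a run is counted and the counting for a new run begins from scratch with the next trial. $Y$ is the index of the trial at which the $r$-th such run is completed; equivalently, $Y$ is the sum of $r$ independent copies of the waiting time for the first run of $k$ consecutive successes. Notation: $(x)_n=x(x-1)\cdots(x-n+1)$ is the falling factorial, with $(x)_0=1$. *)

(* Defs.v *)
From HB Require Import structures.
From mathcomp Require Import all_boot all_order all_algebra finmap.
From mathcomp Require Import all_classical all_reals all_analysis.

Set Implicit Arguments.
Unset Strict Implicit.
Unset Printing Implicit Defensive.
Import Order.TTheory GRing.Theory Num.Theory.

Local Open Scope classical_set_scope.
Local Open Scope ring_scope.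

Definition mutually_independent (d : measure_display) (T : measurableType d)
    (R : realType) (P : probability T R)
    (d' : measure_display) (T' : measurableType d')
    (X : nat -> {RV P >-> T'}) : Prop :=
  forall (J : {fset nat}) (B : nat -> set T'),
    (forall i, measurable (B i)) ->
    P (\bigcap_(i in [set` J]) (X i @^-1` B i)) =
    (\prod_(i <- J) P (X i @^-1` B i))%E.

(* [X t] is the outcome of the trial of index [t.+1] ([true] is a success). *)
Definition bernoulli_trials (d : measure_display) (T : measurableType d)
    (R : realType) (P : probability T R) (p : R)
    (X : nat -> {RV P >-> bool}) : Prop :=
  mutually_independent X /\
  forall t (A : set bool), distribution P (X t) A = bernoulli_prob p A.

(* Number of consecutive successes at the end of the first [n] trials that
   count towards the next run: it is reset by a failure and also, since runs do
   not overlap, by the completion of a run of length [k]. *)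
Fixpoint streak (k : nat) (x : nat -> bool) (n : nat) : nat :=
  if n is t.+1 then
    if x t && ((streak k x t).+1 < k)%N then (streak k x t).+1 else 0%N
  else 0%N.

Definition run_completed (k : nat) (x : nat -> bool) (t : nat) : bool :=
  x t && ((streak k x t).+1 == k).

Definition nb_runs (k : nat) (x : nat -> bool) (n : nat) : nat :=
  \sum_(t < n) run_completed k x t.

(* Index (from 1) of the trial completing the [r]-th run, i.e. the least [n]
   such that [r] runs are completed within the first [n] trials; it is [+oo] on
   the outcomes with fewer than [r] runs. *)
Definition waiting_time (R : realType) (k r : nat) (x : nat -> bool) : \bar R :=
  ereal_inf [set (n%:R%:E : \bar R) | n in [set n | (r <= nb_runs k x n)%N]].

(* Falling factorial of an extended real; it is [+oo] at [+oo] for [0 < n]. *)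
Definition effact (R : realType) (x : \bar R) (n : nat) : \bar R :=
  (\prod_(i < n) (x - i%:R%:E))%E.

Definition momentC (R : realType) (p : R) (k j : nat) : R :=
  let q := 1 - p in
  j`!%:R / (q ^+ j * p ^+ k) *
    (p ^+ (j - 1) * (1 - p ^+ k)
     - p ^+ k * \sum_(1 <= i < j) 'C(k, i)%:R * p ^+ (j - i - 1) * q ^+ i)
  - (k ^_ j)%:R.

(* Main.v *)
Require Import Defs.
From HB Require Import structures.
From mathcomp Require Import all_boot all_order all_algebra finmap.
From mathcomp Require Import all_classical all_reals all_analysis.
From mathcomp Require Import measurable_realfun.
From mathcomp Require Import ring lra zify.
Import Order.TTheory GRing.Theory Num.Theory.

Local Open Scope classical_set_scope.
Local Open Scope ring_scope.

(** Write q = 1 - p. Cut the sequence of trials into attempts to build a run: an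
    attempt is either a success, made of k successes in a row, or a failure,
    made of s < k successes followed by a failed trial. The successful attempts
    up to the r-th use r * k trials, so Z = Y - r k is the number of trials
    spent in failed attempts. A failed attempt with s successes has probability
    q p^s and spends s + 1 trials; its contribution to the factorial moment
    generating function, in the variable 1 + u, is

      W(u) = q (1 + u) sum_(s < k) (p (1 + u))^s = sum_j [runcoef p k j] u^j,

    and W(0) = 1 - p^k. If H_r(u) = E[(1 + u)^Z] = sum_n M_(n) u^n / n!, the
    decomposition at the first attempt gives H_r = W H_r + p^k H_(r-1), that is
    H_r = H_(r-1) + sum_(j > 0) c_j u^j H_r with c_j = [runcoef p k j] / p^k and
    H_0 = 1. Hence H_r = (1 - sum_j c_j u^j)^(-r), whose coefficients are the
    sums over tuples of the theorem: [negpow_coefS] and [negpow_coef0] show that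
    these sums obey the same recursion. Finally c_j = C_j / j!, by induction on
    k ([runcoef_closed], [momentC_runcoef]).

    The recursion is an identity between formal power series, which is only
    meaningful once the moments are known to be finite. To get both at once, let
    [occ] N j s m be the sum over the times t < N of the probability that after t
    trials j runs are complete and the current streak is s, times the binomial
    coefficient of the number t - j k - s of spent trials over m. These are
    finite sums, related to each other by the one-step transitions of the pair
    (runs, streak) and the Vandermonde convolution ([occSS], [occS0]). They
    increase with N, and the recursion bounds them, because the coefficient
    W(0) in front of the unknown is less than 1 ([occ_bounded]). So the limits
    exist and the recursion passes to them ([occ_coefS]). The case m = 0 says
    that Y is almost surely finite.

    The transitions hold because an event that depends on the first t trials is
    independent of the next trial ([prefix_indep]): it is a disjoint union
    of cylinders, for which independence is the hypothesis on the trials. *)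

(** * The coefficients of a failed attempt *)

(** The coefficient of u^j in q (1 + u) sum_(s < k) (p (1 + u))^s: the expected
    number of ways to choose j of the trials of an attempt, on the event that
    the attempt fails. *)
Definition runcoef {R : comNzRingType} (p : R) (k j : nat) : R :=
  (1 - p) * \sum_(s < k) p ^+ s * 'C(s.+1, j)%:R.

Lemma runcoef0 {R : comNzRingType} (p : R) (k : nat) :
  runcoef p k 0 = 1 - p ^+ k.
Proof.
rewrite /runcoef; under eq_bigr do rewrite bin0 mulr1.
rewrite -[in RHS](expr1n _ k) subrXX.
by under [in RHS]eq_bigr do rewrite expr1n mul1r.
Qed.

Lemma runcoef_gt {R : comNzRingType} (p : R) (k j : nat) :
  (k < j)%N -> runcoef p k j = 0.
Proof.
move=> kj; rewrite /runcoef big1 ?mulr0// => s _.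
by rewrite bin_small ?mulr0//; apply: leq_ltn_trans (ltn_ord s) kj.
Qed.

Lemma runcoef_ge0 {R : realType} (p : R) (k j : nat) :
  0 < p -> p < 1 -> 0 <= runcoef p k j.
Proof.
move=> p0 p1; apply: mulr_ge0; first by rewrite subr_ge0 ltW.
by apply: sumr_ge0 => s _; rewrite mulr_ge0// exprn_ge0// ltW.
Qed.

(** With S_k the sum on the right-hand side, Pascal's rule gives
    p S_(k+1) = S_k - q^(j+1) binom(k, j), from which the increment of the
    right-hand side in k is q^(j+1) times q p^k binom(k+1, j+1), as on the
    left. *)
Lemma runcoef_closed {R : comNzRingType} (p : R) (k j : nat) :
  (1 - p) ^+ j.+1 * runcoef p k j.+1 =
  p ^+ j - p ^+ k * \sum_(i < j.+1) 'C(k, i)%:R * p ^+ (j - i) * (1 - p) ^+ i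
  - p ^+ k * (1 - p) ^+ j.+1 * 'C(k, j.+1)%:R.
Proof.
pose q := 1 - p.
elim: k => [|k IH].
  rewrite /runcoef big_ord0 mulr0 mulr0 expr0 !mul1r bin0n mulr0 subr0.
  rewrite big_ord_recl big1 ?addr0 => [|i _]; last by rewrite bin0n /= !mul0r.
  by rewrite bin0 subn0 expr0 mulr1 mul1r subrr.
rewrite /runcoef big_ord_recr /= 2!mulrDr -/(runcoef p k j.+1) IH.
pose S k := \sum_(i < j.+1) 'C(k, i)%:R * p ^+ (j - i) * q ^+ i.
rewrite -/q -/(S k) -/(S k.+1).
suff E : p * S k.+1 = S k - q ^+ j.+1 * 'C(k, j)%:R.
  by rewrite (exprS p k) -(mulrAC p) E binS natrD exprS /q; ring.
have -> : S k.+1 = S k + \sum_(i < j) 'C(k, i)%:R * p ^+ (j - i.+1) * q ^+ i.+1.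
  rewrite /S big_ord_recl [in X in _ = X + _]big_ord_recl !bin0 -addrA.
  congr (_ + _); rewrite -big_split /=; apply: eq_bigr => i _.
  by rewrite /bump /= add1n binS natrD -!mulrA mulrDl.
suff H : (\sum_(i < j) 'C(k, i)%:R * p ^+ (j - i.+1) * q ^+ i.+1) * p
           = q * (S k - 'C(k, j)%:R * q ^+ j).
  by rewrite mulrDr (mulrC p (\sum_(i < j) _)) H exprS /q; ring.
rewrite /S big_ord_recr /= subnn expr0 mulr1 addrK mulr_sumr mulr_suml.
apply: eq_bigr => i _.
by rewrite -(subnSK (ltn_ord i)) !exprS; ring.
Qed.

Lemma momentC_runcoef {R : realType} (p : R) (k j : nat) : 0 < p -> p < 1 ->
  (0 < j)%N -> momentC p k j / j`!%:R = runcoef p k j / p ^+ k.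
Proof.
case: j => // j p0 p1 _.
have q0 : (1 - p) ^+ j.+1 != 0 by rewrite expf_neq0// subr_eq0 gt_eqF.
have pk0 : p ^+ k != 0 by rewrite expf_neq0// gt_eqF.
have f0 : j.+1`!%:R != 0 :> R by rewrite pnatr_eq0 -lt0n fact_gt0.
have H := runcoef_closed p k j.
rewrite /momentC.
(* The missing term of index 0 accounts for the summand p^j of [momentC]. *)
have -> : \sum_(1 <= i < j.+1) 'C(k, i)%:R * p ^+ (j.+1 - i - 1) * (1 - p) ^+ i
 = \sum_(i < j.+1) 'C(k, i)%:R * p ^+ (j - i) * (1 - p) ^+ i - p ^+ j.
  rewrite -(big_mkord xpredT
    (fun i => 'C(k, i)%:R * p ^+ (j - i) * (1 - p) ^+ i)).
  rewrite [in RHS]big_ltn// bin0 subn0 expr0 mulr1 mul1r addrAC subrr add0r.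
  by apply: eq_big_nat => i _; rewrite subnAC subn1.
have -> : runcoef p k j.+1 =
    ((1 - p) ^+ j.+1 * runcoef p k j.+1) / (1 - p) ^+ j.+1.
  by rewrite mulrC mulKf.
rewrite H -bin_ffact natrM subn1 /=.
field.
by rewrite q0 pk0 f0.
Qed.

(** * Coefficients of a negative power *)

(** For n <= N, the coefficient of u^n in (1 - sum_(0 < j <= k) c_j u^j)^(-r),
    by the multinomial theorem. The bound N on the exponents does not change
    the sum as long as n <= N; fixing it lets all the n <= N share one index
    type. The factor with the falling factorial is correct for r = 0 too: the
    truncated subtraction makes it vanish unless all the exponents are 0. *)
Definition negpow_coef {R : numFieldType} (c : nat -> R) (k N r n : nat) : R :=
  \sum_(m : {ffun 'I_k -> 'I_N.+1} | (\sum_(j < k) j.+1 * m j == n)%N)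
     ((r + \sum_(j < k) m j - 1) ^_ (\sum_(j < k) m j))%N%:R *
     \prod_(j < k) (((m j)`!%:R)^-1 * c j.+1 ^+ m j).

Lemma ffactSS_add (x s : nat) :
  (x.+1 ^_ s.+1 = x ^_ s.+1 + s.+1 * x ^_ s)%N.
Proof.
rewrite ffactSS ffactnSr.
have [sx|xs] := leqP s x.
  by rewrite mulnC [(s.+1 * _)%N]mulnC -mulnDr; congr muln; lia.
by rewrite ffact_small// !muln0.
Qed.

Definition ffincr {k N : nat} (j : 'I_k) (m : {ffun 'I_k -> 'I_N.+1}) :
    {ffun 'I_k -> 'I_N.+1} :=
  [ffun i => if i == j then inord (m i).+1 else m i].

Definition ffdecr {k N : nat} (j : 'I_k) (m : {ffun 'I_k -> 'I_N.+1}) :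
    {ffun 'I_k -> 'I_N.+1} :=
  [ffun i => if i == j then inord (m i).-1 else m i].

Lemma ffdecrK {k N : nat} (j : 'I_k) (m : {ffun 'I_k -> 'I_N.+1}) :
  (0 < m j)%N -> ffincr j (ffdecr j m) = m.
Proof.
move=> mj; apply/ffunP => i; rewrite !ffunE; case: eqP => // ->.
apply: val_inj; have := ltn_ord (m j) => mN.
by rewrite /= !inordK ?prednK //; lia.
Qed.

Lemma ffincr_sum {k N : nat} (j : 'I_k) (m : {ffun 'I_k -> 'I_N.+1})
    (a : 'I_k -> nat) : (m j < N)%N ->
  (\sum_(i < k) a i * ffincr j m i = a j + \sum_(i < k) a i * m i)%N.
Proof.
move=> mj; rewrite (bigD1 j)//= [in RHS](bigD1 j)//= addnA ffunE eqxx.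
rewrite inordK ?ltnS// mulnS; congr addn.
by apply: eq_bigr => i /negPf ij; rewrite ffunE ij.
Qed.

Lemma ffincr_sum1 {k N : nat} (j : 'I_k) (m : {ffun 'I_k -> 'I_N.+1}) :
  (m j < N)%N ->
  (\sum_(i < k) ffincr j m i = (\sum_(i < k) m i).+1)%N.
Proof.
move=> mj; have := @ffincr_sum k N j m (fun=> 1%N) mj.
under eq_bigr do rewrite mul1n.
by under [X in _ = addn _ X]eq_bigr do rewrite mul1n.
Qed.

(** [ffincr j] and [ffdecr j] are inverse bijections between the tuples of
    weight n - (j + 1) and the tuples of weight n with a positive j-th entry. *)
Lemma ffincr_reindex {R : numFieldType} {k N n : nat} (j : 'I_k)
    (F : {ffun 'I_k -> 'I_N.+1} -> R) : (n <= N)%N -> (j < n)%N ->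
  \sum_(m : {ffun 'I_k -> 'I_N.+1} |
      (\sum_(i < k) i.+1 * m i == n)%N && (0 < m j)%N) F m =
  \sum_(m : {ffun 'I_k -> 'I_N.+1} | (\sum_(i < k) i.+1 * m i == n - j.+1)%N)
      F (ffincr j m).
Proof.
move=> nN jn.
rewrite (reindex_onto (ffincr j) (ffdecr j)) => [|m /andP[_]]; last first.
  exact: ffdecrK.
apply: eq_bigl => m.
have [mj|mj] := ltnP (m j) N; last first.
  rewrite {2}/ffincr !ffunE eqxx.
  (* An entry as large as N exceeds the weight n - (j + 1), and [inord] turns
     its out-of-range successor into 0: both conditions fail. *)
  have -> : inord (m j).+1 = ord0 :> 'I_N.+1.
    by rewrite /inord /insubd insubF//= ltnS ltnNge mj.
  rewrite /= ltnn andbF /=; apply/esym/negbTE.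
  rewrite neq_ltn; apply/orP; right.
  rewrite (bigD1 j)//=; apply: leq_trans (leq_addr _ _).
  by apply: leq_trans (leq_pmull (m j) (ltn0Sn j)); lia.
rewrite (@ffincr_sum k N j m (fun i => i.+1))// {2}/ffincr !ffunE eqxx.
rewrite inordK ?ltnS//= andbT.
rewrite (_ : ffdecr _ _ == m); last first.
  apply/eqP/ffunP => i; rewrite !ffunE; case: eqP => // ->.
  rewrite inordK ?ltnS//=.
  by apply: val_inj; rewrite /= inordK.
by rewrite andbT -(subnKC jn) eqn_add2l addKn.
Qed.

(** Pascal's rule for the falling factorial, (r + s)_s = (r + s - 1)_s
    + s (r + s - 1)_(s-1), splits each summand; in the second part the factor
    s = sum_j m_j is distributed, and the j-th term is reindexed by removing one
    unit of m_j, which cancels the factor m_j against m_j! and releases c_j. *)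
Lemma negpow_coefS {R : numFieldType} (c : nat -> R) (k N r n : nat) :
  (n <= N)%N ->
  negpow_coef c k N r.+1 n = negpow_coef c k N r n +
    \sum_(j < k | (j < n)%N) c j.+1 * negpow_coef c k N r.+1 (n - j.+1).
Proof.
move=> nN.
pose mon (m : {ffun 'I_k -> 'I_N.+1}) : R :=
  \prod_(j < k) (((m j)`!%:R)^-1 * c j.+1 ^+ m j).
pose G (m : {ffun 'I_k -> 'I_N.+1}) : R :=
  ((r + (\sum_(j < k) m j).-1) ^_ (\sum_(j < k) m j).-1)%:R * mon m.
have E (m : {ffun 'I_k -> 'I_N.+1}) :
    ((r.+1 + \sum_(j < k) m j - 1) ^_ (\sum_(j < k) m j))%N%:R * mon m =
    ((r + \sum_(j < k) m j - 1) ^_ (\sum_(j < k) m j))%N%:R * mon m +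
    \sum_(j < k) (m j)%:R * G m.
  rewrite -mulr_suml -natr_sum /G.
  case: (\sum_(j < k) m j)%N => [|s]; first by rewrite !ffactn0 mul0r addr0.
  rewrite addSn subn1 /= addnS subn1 /= ffactSS_add natrD mulrDl natrM.
  by rewrite -mulrA.
rewrite /negpow_coef.
under eq_bigr do rewrite E.
rewrite big_split /=; congr (_ + _).
rewrite exchange_big /= [RHS]big_mkcond /=; apply: eq_bigr => j _.
case: ifPn => [jn|]; last first.
  rewrite -leqNgt => nj; apply: big1 => m /eqP wm.
  suff -> : m j = 0%N :> nat by rewrite mul0r.
  apply/eqP; rewrite -leqn0 leqNgt; apply/negP => mj.
  suff : (n < n)%N by rewrite ltnn.
  apply: (leq_ltn_trans nj); rewrite -wm (bigD1 j)//=.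
  by apply: leq_trans (leq_addr _ _); rewrite leq_pmulr.
rewrite (bigID (fun m : {ffun 'I_k -> 'I_N.+1} => (0 < m j)%N)) /=.
rewrite [X in _ + X]big1 ?addr0 => [|m /andP[_]]; last first.
  by rewrite -leqNgt leqn0 => /eqP ->; rewrite mul0r.
rewrite ffincr_reindex// mulr_sumr; apply: eq_bigr => m /eqP wm.
have mj : (m j < N)%N.
  apply: leq_trans nN; apply: leq_trans (_ : (n - j.+1).+1 <= _)%N; last by lia.
  rewrite ltnS -wm (bigD1 j)//=; apply: leq_trans (leq_addr _ _).
  by rewrite leq_pmull.
rewrite /G ffincr_sum1//= mulrCA [in RHS]mulrCA addSn subn1 /=; congr (_ * _).
rewrite /mon (bigD1 j)//= [in RHS](bigD1 j)//= !mulrA; congr (_ * _); last first.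
  by apply: eq_bigr => i /negPf ij; rewrite ffunE ij.
rewrite ffunE eqxx inordK ?ltnS// factS natrM invfM exprS.
have : (m j).+1%:R != 0 :> R by rewrite pnatr_eq0.
have : (m j)`!%:R != 0 :> R by rewrite pnatr_eq0 -lt0n fact_gt0.
by move=> a0 b0; field; rewrite a0 addrC natr1 b0.
Qed.

Lemma negpow_coef0 {R : numFieldType} (c : nat -> R) (k N n : nat) :
  negpow_coef c k N 0 n = (n == 0)%:R.
Proof.
rewrite /negpow_coef (bigID (fun m => m == [ffun=> ord0])) /=.
rewrite [X in _ + X]big1 ?addr0 => [|m /andP[_ m0]]; last first.
  suff : (0 < \sum_(j < k) m j)%N.
    case: (\sum_(j < k) m j)%N => // s _.
    by rewrite add0n subn1 /= ffact_small// mul0r.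
  rewrite lt0n; apply: contraNneq m0 => /eqP; rewrite sum_nat_eq0 => /forallP H.
  by apply/eqP/ffunP => i; rewrite ffunE; apply/val_inj/eqP/(implyP (H i)).
have [->|n0] := eqVneq n 0%N.
  rewrite (big_pred1 [ffun=> ord0]) => [|m]; last first.
    rewrite /=; case: (m =P [ffun=> ord0]) => [->|_]; rewrite ?andbF ?andbT //.
    by apply/eqP/big1 => j _; rewrite ffunE muln0.
  rewrite !big1 ?mulr1 => [//|j _|j _]; rewrite ffunE//.
  by rewrite fact0 invr1 mul1r expr0.
rewrite big_pred0// => m; apply/negP => /andP[/eqP wm /eqP m0].
by move: n0; rewrite -wm m0 big1 ?eqxx// => j _; rewrite ffunE muln0.
Qed.

(** * Occupation sums of the chain of runs and streaks *)

(** What is used of the law nu t j s = P(after t trials, j runs are complete and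
    the current streak is s): the one-step transitions of this Markov chain, and
    the fact that j runs and a streak of s need j k + s trials. *)
Record run_chain_law {R : realType} (p : R) (k : nat)
    (nu : nat -> nat -> nat -> R) : Prop := RunChainLaw {
  law_ge0 : forall t j s, 0 <= nu t j s ;
  law_early : forall t j s, (t < j * k + s)%N -> nu t j s = 0 ;
  law_init : forall j s, nu 0 j s = ((j == 0%N) && (s == 0%N))%:R ;
  law_success : forall t j s, (s.+1 < k)%N -> nu t.+1 j s.+1 = p * nu t j s ;
  law_reset : forall t j, nu t.+1 j 0 =
    (if j is j'.+1 then p * nu t j' k.-1 else 0) +
    (1 - p) * \sum_(s < k) nu t j s }.

Section occupation.
Import numFieldNormedType.Exports.
Context {R : realType} {p : R} {k : nat} {nu : nat -> nat -> nat -> R}.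
Hypotheses (k0 : (0 < k)%N) (p0 : 0 < p) (p1 : p < 1).
Hypothesis law : run_chain_law p k nu.
Let nu_ge0 := law_ge0 _ _ _ law.
Let nu_early := law_early _ _ _ law.
Let nu_init := law_init _ _ _ law.
Let nuS := law_success _ _ _ law.
Let nuS0 := law_reset _ _ _ law.

(** Over the times t < N at which the chain is in state (j, s), the expected
    total number of ways to choose m of the t - j k - s trials spent in failed
    attempts. *)
Definition occ (N j s m : nat) : R :=
  \sum_(t < N) nu t j s * 'C(t - j * k - s, m)%:R.

Lemma occ_leS N j s m : occ N j s m <= occ N.+1 j s m.
Proof. by rewrite /occ big_ord_recr /= lerDl mulr_ge0. Qed.

(** A success that does not complete a run spends no trial in a failed
    attempt. *)
Lemma occSS N j s m : (s.+1 < k)%N -> occ N.+1 j s.+1 m = p * occ N j s m.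
Proof.
move=> sk; rewrite /occ big_ord_recl nu_init andbF mul0r add0r mulr_sumr.
apply: eq_bigr => t _; rewrite lift0 nuS// mulrA.
by congr (_ * 'C(_, _)%:R); lia.
Qed.

(** The streak is 0 at the start, after completing a run, or after a failure. A
    failure at streak s adds s + 1 spent trials; choosing i of the m trials among
    these gives the convolution. *)
Lemma occS0 N j m : occ N.+1 j 0 m =
  (if j is j'.+1 then p * occ N j' k.-1 m else (m == 0%N)%:R) +
  (1 - p) * \sum_(s < k) \sum_(i < m.+1) 'C(s.+1, i)%:R * occ N j s (m - i).
Proof.
rewrite /occ big_ord_recl nu_init andbT.
under eq_bigr => t _ do rewrite lift0 nuS0 mulrDl.
rewrite big_split /= addrA; congr (_ + _).
  case: j => [|j].
    rewrite /= mul1r big1 => [|i _]; last by rewrite mul0r.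
    by rewrite addr0 bin0n.
  rewrite mul0r add0r mulr_sumr; apply: eq_bigr => t _.
  rewrite mulrA; congr (_ * 'C(_, _)%:R).
  by rewrite mulSn; case: (k) k0 => // k' _ /=; lia.
under [LHS]eq_bigr do rewrite -mulrA; rewrite -[LHS]mulr_sumr; congr (_ * _).
under [LHS]eq_bigr do rewrite mulr_suml.
rewrite exchange_big /=; apply: eq_bigr => s _.
under [RHS]eq_bigr do rewrite mulr_sumr.
rewrite [RHS]exchange_big /=; apply: eq_bigr => t _.
have [tjs|tjs] := ltnP t (j * k + s).
  by rewrite nu_early// mul0r big1// => i _; rewrite mul0r mulr0.
rewrite (_ : t.+1 - j * k - 0 = s.+1 + (t - j * k - s))%N; last by lia.
rewrite -binomial.Vandermonde natr_sum mulr_sumr; apply: eq_bigr => i _.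
by rewrite natrM mulrCA.
Qed.

Lemma occ_le N j s m : (s < k)%N -> occ N j s m <= p ^+ s * occ N j 0 m.
Proof.
elim: s => [|s IH] sk; first by rewrite mul1r.
apply: (le_trans (occ_leS N j s.+1 m)); rewrite occSS// exprS -mulrA.
by rewrite ler_pM2l// IH// ltnW.
Qed.

(** The failure term of [occS0] in terms of the streak 0 only, the sum over the
    streaks producing the coefficients [runcoef]. *)
Lemma sum_occ_le N j m :
  (1 - p) * \sum_(s < k) \sum_(i < m.+1) 'C(s.+1, i)%:R * occ N j s (m - i) <=
  \sum_(i < m.+1) runcoef p k i * occ N j 0 (m - i).
Proof.
rewrite /runcoef; under [leRHS]eq_bigr do rewrite -mulrA mulr_suml.
rewrite -mulr_sumr ler_wpM2l//; first by rewrite subr_ge0 ltW.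
rewrite [leLHS]exchange_big /=; apply: ler_sum => i _; apply: ler_sum => s _.
by rewrite (mulrC (p ^+ s)) -mulrA ler_wpM2l// occ_le.
Qed.

(** By monotonicity in N, [occ N j 0 m] is at most the next sum, which by [occS0]
    is at most (1 - p^k) times [occ N j 0 m] plus terms of smaller indices. *)
Lemma occ_bounded_step j m B0 B1 :
  (forall N, (if j is j'.+1 then p * occ N j' k.-1 m else (m == 0%N)%:R) <= B0) ->
  (forall m' N, (m' < m)%N -> occ N j 0 m' <= B1) ->
  exists B : R, forall N, occ N j 0 m <= B.
Proof.
move=> H0 H1; exists ((B0 + \sum_(i < m) runcoef p k i.+1 * B1) / p ^+ k) => N.
rewrite ler_pdivlMr ?exprn_gt0//.
have H := occ_leS N j 0 m; rewrite [leRHS]occS0 in H.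
have {}H := le_trans H (lerD (H0 N) (sum_occ_le N j m)).
rewrite big_ord_recl subn0 runcoef0 in H.
have S : \sum_(i < m) runcoef p k (bump 0 i) * occ N j 0 (m - bump 0 i) <=
         \sum_(i < m) runcoef p k i.+1 * B1.
  apply: ler_sum => i _; rewrite /bump /= add1n ler_wpM2l ?runcoef_ge0//.
  by apply: H1; have := ltn_ord i; lia.
by rewrite /= in H S; lra.
Qed.

Lemma occ_bounded j m : exists B : R, forall N, occ N j 0 m <= B.
Proof.
suff H n : exists B : R, forall m' N, (m' < n)%N -> occ N j 0 m' <= B.
  by have [B HB] := H m.+1; exists B => N; exact: HB.
elim: j {m} n => [|j IHj]; (elim => [|m [B1 HB1]]; first by exists 0).
- have [B HB] := @occ_bounded_step 0 m _ B1 (fun=> lexx _) HB1.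
  exists (Num.max B1 B) => m' N; rewrite ltnS leq_eqVlt le_max.
  by case/predU1P => [->|m'm]; [rewrite HB orbT|rewrite HB1].
- have [B0 HB0] := IHj m.+1.
  have H0 N : p * occ N j k.-1 m <= p * (p ^+ k.-1 * B0).
    rewrite ler_pM2l//; apply: le_trans (occ_le N j k.-1 m _) _.
      by rewrite prednK.
    by rewrite ler_pM2l ?exprn_gt0// HB0.
  have [B HB] := @occ_bounded_step j.+1 m _ B1 H0 HB1.
  exists (Num.max B1 B) => m' N; rewrite ltnS leq_eqVlt le_max.
  by case/predU1P => [->|m'm]; [rewrite HB orbT|rewrite HB1].
Qed.

Definition occ_lim j m : R := limn (fun N => occ N j 0 m).

Lemma cvg_occ j s m : (s < k)%N ->
  (fun N => occ N j s m) @ \oo --> p ^+ s * occ_lim j m.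
Proof.
elim: s => [|s IH] sk.
  rewrite mul1r; apply: nondecreasing_is_cvgn.
    by apply/nondecreasing_seqP => N; exact: occ_leS.
  have [B HB] := occ_bounded j m; exists B => _ [N _ <-]; exact: HB.
rewrite -cvg_shiftS; under eq_fun do rewrite occSS//.
by rewrite exprS -mulrA; apply: cvgMl_tmp; apply: IH; rewrite ltnW.
Qed.

(** The r-th completion happens from the streak k - 1 after r - 1 runs, by a
    success: its moments are p * p^(k-1) times those of the state (r - 1, 0). So
    this is the coefficient of u^m in E[(1 + u)^Z] for the r-th completion. For
    r = 0 the waiting time is 0. *)
Definition occ_coef (r m : nat) : R :=
  if r is j.+1 then p ^+ k * occ_lim j m else (m == 0%N)%:R.

Lemma occ_limE j m : occ_lim j m = occ_coef j m +
  \sum_(i < m.+1) runcoef p k i * occ_lim j (m - i).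
Proof.
have H : (fun N => occ N.+1 j 0 m) @ \oo --> p ^+ 0 * occ_lim j m.
  by rewrite (cvg_shiftS (fun N => occ N j 0 m)); exact: cvg_occ.
rewrite mul1r in H.
suff H' : (fun N => occ N.+1 j 0 m) @ \oo --> occ_coef j m +
    \sum_(i < m.+1) runcoef p k i * occ_lim j (m - i).
  exact: (cvg_unique _ H H').
under eq_fun do rewrite occS0.
apply: cvgD.
  case: j {H} => [|j]; first exact: cvg_cst.
  have pkE : p ^+ k = p * p ^+ k.-1 by rewrite -exprS prednK.
  rewrite /= pkE -mulrA; apply: cvgMl_tmp.
  by apply: cvg_occ; rewrite prednK.
rewrite /runcoef.
under [X in _ --> X]eq_bigr do rewrite -mulrA mulr_suml.
rewrite -mulr_sumr exchange_big /=; apply: cvgMl_tmp.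
apply: cvg_big => [|s _]; first exact: add_continuous.
apply: cvg_big => [|i _]; first exact: add_continuous.
rewrite (mulrC (p ^+ s)) -mulrA; apply: cvgMl_tmp.
exact: cvg_occ.
Qed.

(** The term of index 0 in [occ_limE] is (1 - p^k) times the left-hand side;
    moving it to the left leaves p^k times the limit. *)
Lemma occ_coefS r m : occ_coef r.+1 m = occ_coef r m +
  \sum_(i < m) runcoef p k i.+1 / p ^+ k * occ_coef r.+1 (m - i.+1).
Proof.
rewrite /=.
have pk0 : p ^+ k != 0 by rewrite expf_neq0// gt_eqF.
have H := occ_limE r m; rewrite big_ord_recl subn0 runcoef0 in H.
under [X in _ = _ + X]eq_bigr do rewrite mulrA mulfVK//.
by move: H; under [X in _ = _ + (_ + X) -> _]eq_bigr do rewrite lift0; lra.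
Qed.

End occupation.

Arguments occ {R} k nu N j s m.
Arguments occ_coef {R} p k nu r m.

(** Both sides obey the same recursion. It stops at min(n, k): on the left
    because [runcoef] vanishes above k, on the right because a tuple has k
    entries. *)
Lemma occ_coef_negpow {R : realType} {p : R} {k : nat}
    {nu : nat -> nat -> nat -> R} : (0 < k)%N -> 0 < p -> p < 1 ->
  run_chain_law p k nu -> forall N r n, (n <= N)%N ->
  occ_coef p k nu r n =
  negpow_coef (fun j => runcoef p k j / p ^+ k) k N r n.
Proof.
move=> k0 p0 p1 law N; elim=> [|r IHr] n; first by rewrite negpow_coef0.
elim/ltn_ind: n => n IHn nN.
rewrite (occ_coefS k0 p0 p1 law) negpow_coefS// IHr//; congr (_ + _).
pose F i := runcoef p k i.+1 / p ^+ k * occ_coef p k nu r.+1 (n - i.+1).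
transitivity (\sum_(0 <= i < n + k | (i < k)%N && (i < n)%N) F i).
  rewrite -(big_nat_widen _ _ _ (fun i => (i < k)%N))//; last exact: leq_addr.
  rewrite big_mkord [RHS]big_mkcond /=; apply: eq_bigr => i _.
  by case: ltnP => // ki; rewrite /F runcoef_gt// !mul0r.
under eq_bigl do rewrite andbC.
rewrite -(big_nat_widen _ _ _ (fun i => (i < n)%N)); last exact: leq_addl.
rewrite big_mkord; apply: eq_bigr => i ik; rewrite /F IHn//; first by lia.
by lia.
Qed.

(** * Runs in a fixed sequence of trials *)

Lemma nb_runsS k x t :
  nb_runs k x t.+1 = (nb_runs k x t + run_completed k x t)%N.
Proof. by rewrite /nb_runs big_ord_recr. Qed.

Lemma streak_lt k x t : (0 < k)%N -> (streak k x t < k)%N.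
Proof. by move=> k0; elim: t => //= t IH; case: ifP => // /andP[]. Qed.

(** The difference is the number of trials spent in failed attempts. *)
Lemma nb_runs_streak_le k x t : (0 < k)%N ->
  (nb_runs k x t * k + streak k x t <= t)%N.
Proof.
move=> k0; elim: t => [|t IH]; first by rewrite /nb_runs big_ord0.
rewrite nb_runsS /= /run_completed; have := streak_lt k x t k0.
case: (x t) => /=; last by rewrite !addn0; lia.
case: (ltngtP (streak k x t).+1 k) => //= E _;
  by rewrite ?addn0 ?addn1 ?mulSn; lia.
Qed.

Lemma streak_prefix k x y t : (forall i, (i < t)%N -> x i = y i) ->
  streak k x t = streak k y t.
Proof.
elim: t => //= t IH xy; rewrite IH => [|i it]; last by rewrite xy// ltnW.
by rewrite xy.
Qed.

Lemma nb_runs_prefix k x y t : (forall i, (i < t)%N -> x i = y i) ->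
  nb_runs k x t = nb_runs k y t.
Proof.
move=> xy; apply: eq_bigr => i _; rewrite /run_completed xy//.
by rewrite (@streak_prefix k x y)// => j ji; apply: xy; apply: ltn_trans ji _.
Qed.

Lemma streakS_eqS k x t s : (streak k x t.+1 == s.+1) =
  [&& x t, (s.+1 < k)%N & streak k x t == s].
Proof.
rewrite /=; case: ifP => [/andP[-> sk]|]; rewrite ?eqSS /=.
  by case: eqP => [<-|]; rewrite ?sk ?andbF.
by case: (x t) => //= H; case: (streak k x t =P s) => [<-|]; rewrite ?H ?andbF.
Qed.

Lemma state_streakS k x t j s : (s.+1 < k)%N ->
  (nb_runs k x t.+1 == j) && (streak k x t.+1 == s.+1) =
  ((nb_runs k x t == j) && (streak k x t == s)) && x t.
Proof.
move=> sk; rewrite streakS_eqS sk /= nb_runsS /run_completed.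
case: (x t); rewrite ?andbF//= andbT.
by case: (streak k x t =P s) => [->|]; rewrite ?andbF// (ltn_eqF sk) addn0 andbT.
Qed.

(** A streak is 0 after a trial either because the trial completes a run, or
    because it fails, whatever the previous streak. *)
Lemma state_streak0 k x t j : (0 < k)%N ->
  (nb_runs k x t.+1 == j) && (streak k x t.+1 == 0%N) =
  ((0 < j)%N && ((nb_runs k x t == j.-1) && (streak k x t == k.-1)) && x t)
  || ((nb_runs k x t == j) && ~~ x t).
Proof.
case: k => // k _; rewrite nb_runsS /run_completed /=.
have := streak_lt k.+1 x t (ltn0Sn k).
case: (x t) => /=; last by rewrite addn0 eqxx !andbF.
rewrite andbF orbF andbT eqSS !ltnS.
case: (ltngtP (streak k.+1 x t) k) => // [_|_] _; rewrite /= ?andbF//.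
by rewrite addn1 !andbT; case: j.
Qed.

(** * Independence of a trial from the past *)

Lemma bigcap_cyl {T : Type} (X : nat -> T -> bool) (v : nat -> bool) (t : nat) :
  [set w | forall i, (i < t)%N -> X i w = v i] =
  \bigcap_(i in [set` [fset i | i in iota 0 t]%fset]) (X i @^-1` [set v i]).
Proof.
apply/seteqP; split => w /= H i.
  by rewrite /= !inE /= mem_iota add0n => it; exact: H.
by move=> it; apply: H; rewrite /= !inE /= mem_iota.
Qed.

(** An event that depends on the first t coordinates is a disjoint union of
    cylinders of length t: split it according to one coordinate after the
    other. *)
Lemma prefix_event_ind {T : Type} (X : nat -> T -> bool) (K : set T -> Prop)
    (phi : (nat -> bool) -> Prop) (t : nat) :
  K set0 ->
  (forall A B, A `&` B = set0 -> K A -> K B -> K (A `|` B)) ->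
  (forall v, K [set w | forall i, (i < t)%N -> X i w = v i]) ->
  (forall x y, (forall i, (i < t)%N -> x i = y i) -> phi x -> phi y) ->
  K [set w | phi (X^~ w)].
Proof.
move=> K0 KU Kcyl phit.
(* Downward induction on the length t - d of a prefix v that is prescribed. *)
suff H d v : (d <= t)%N ->
    K [set w | (forall i, (i < t - d)%N -> X i w = v i) /\ phi (X^~ w)].
  have := H t (fun=> true) (leqnn t).
  rewrite subnn; congr K; apply/seteqP; split => w /=; first by case.
  by move=> ?; split.
elim: d v => [|d IH] v dt.
  have [pv|npv] := pselect (phi v).
    rewrite subn0 (_ : mkset _ = [set w | forall i, (i < t)%N -> X i w = v i]) //.
    apply/seteqP; split => w /=; first by case.
    by move=> Xv; split => //; apply: phit pv => i /Xv.
  rewrite (_ : mkset _ = set0)//; apply/seteqP; split => w //= -[Xv pX].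
  by apply: npv; apply: phit pX => i it; apply: Xv; rewrite subn0.
pose c := (t - d.+1)%N.
have ct : (t - d = c.+1)%N by rewrite /c; lia.
pose u b i := if i == c then b else v i.
have -> : [set w | (forall i, (i < t - d.+1)%N -> X i w = v i) /\ phi (X^~ w)] =
    [set w | (forall i, (i < t - d)%N -> X i w = u true i) /\ phi (X^~ w)] `|`
    [set w | (forall i, (i < t - d)%N -> X i w = u false i) /\ phi (X^~ w)].
  rewrite ct -/c; apply/seteqP; split => w /=.
    move=> [Xv pX]; case E : (X c w); [left|right];
      split => // i; rewrite ltnS leq_eqVlt.
      by rewrite /u; case: eqP => [->|_] //=; apply: Xv.
    by rewrite /u; case: eqP => [->|_] //=; apply: Xv.
  by move=> [] [Xu pX]; split => // i ic; rewrite Xu ?ltnS ?(ltnW ic)// /u ltn_eqF.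
apply: KU; [|by apply: IH; lia..].
rewrite ct; apply/seteqP; split => w //= -[[Ht _] [Hf _]].
by have := Ht c (ltnSn c); rewrite Hf// /u eqxx.
Qed.

Section trials.
Context {d : measure_display} {T : measurableType d} {R : realType}.
Context {P : probability T R} {p : R} {X : nat -> {RV P >-> bool}}.
Hypotheses (p0 : 0 < p) (p1 : p < 1) (HX : bernoulli_trials p X).

Lemma trialE t (b : bool) :
  P (X t @^-1` [set b]) = (if b then p else 1 - p)%:E.
Proof.
rewrite (_ : P _ = distribution P (X t) [set b])// HX.2 bernoulli_probE ?ltW//.
have mem1 (x : bool) : (x \in [set b]) = (x == b).
  by apply/idP/eqP; rewrite inE.
by rewrite !diracE !mem1; case: b {mem1}; rewrite /= ?mule0 ?mule1 ?adde0 ?add0e.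
Qed.

Lemma measurable_trial t (b : bool) : measurable (X t @^-1` [set b]).
Proof. exact: measurable_funPTI. Qed.

Lemma measurable_cyl (v : nat -> bool) t :
  measurable [set w | forall i, (i < t)%N -> X i w = v i].
Proof.
rewrite (bigcap_cyl X v t); apply: fin_bigcap_measurable => // i _.
exact: measurable_trial.
Qed.

Lemma measurable_prefix (phi : (nat -> bool) -> Prop) (t : nat) :
  (forall x y, (forall i, (i < t)%N -> x i = y i) -> phi x -> phi y) ->
  measurable [set w | phi (X^~ w)].
Proof.
apply: (@prefix_event_ind T X measurable) => //.
- by move=> A B _; exact: measurableU.
- by move=> v; exact: measurable_cyl.
Qed.

(** Both cylinders are finite intersections covered by mutual independence. *)
Lemma cyl_indep (v : nat -> bool) t :
  P ([set w | forall i, (i < t)%N -> X i w = v i] `&` X t @^-1` [set v t]) =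
  (P [set w | forall i, (i < t)%N -> X i w = v i] * P (X t @^-1` [set v t]))%E.
Proof.
have cylE n : P [set w | forall i, (i < n)%N -> X i w = v i] =
    (\prod_(i < n) P (X i @^-1` [set v i]))%E.
  rewrite (bigcap_cyl X v n) (HX.1 _ (fun i => [set v i]))//.
  rewrite -(big_mkord xpredT (fun i => P (X i @^-1` [set v i]))).
  rewrite /index_iota subn0; apply: perm_big.
  apply: uniq_perm; rewrite ?fset_uniq ?iota_uniq// => i.
  by rewrite !inE.
have -> : [set w | forall i, (i < t)%N -> X i w = v i] `&` X t @^-1` [set v t] =
   [set w | forall i, (i < t.+1)%N -> X i w = v i].
  apply/seteqP; split => w /=.
    by move=> [H Ht] i; rewrite ltnS leq_eqVlt => /predU1P[->//|]; exact: H.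
  by move=> H; split => [i it|]; apply: H => //; exact: ltnW.
by rewrite !cylE big_ord_recr.
Qed.

(** The factorization is additive in the event, so that it extends from the
    cylinders by [prefix_event_ind]. On a cylinder of length t the coordinate t of
    the prefix v is free, and v' sets it to b. *)
Lemma prefix_indep (phi : (nat -> bool) -> Prop) (t : nat) (b : bool) :
  (forall x y, (forall i, (i < t)%N -> x i = y i) -> phi x -> phi y) ->
  P ([set w | phi (X^~ w)] `&` X t @^-1` [set b]) =
  (P [set w | phi (X^~ w)] * (if b then p else 1 - p)%:E)%E.
Proof.
move=> phit; rewrite -(trialE t); set B := X t @^-1` _.
have mB : measurable B by exact: measurable_trial.
suff [] : measurable [set w | phi (X^~ w)] /\
  P ([set w | phi (X^~ w)] `&` B) = (P [set w | phi (X^~ w)] * P B)%E by [].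
apply: (@prefix_event_ind T X
  (fun A => measurable A /\ P (A `&` B) = (P A * P B)%E) phi t) => //.
- by rewrite set0I measure0 mul0e.
- move=> A A' AA' [mA PA] [mA' PA']; split; first exact: measurableU.
  rewrite setIUl measureU//=; [|exact: measurableI..|].
    by rewrite PA PA' measureU// ge0_muleDl.
  by rewrite setIACA AA' set0I.
- move=> v; split; first exact: measurable_cyl.
  pose v' i := if i == t then b else v i.
  have -> : [set w | forall i, (i < t)%N -> X i w = v i] =
            [set w | forall i, (i < t)%N -> X i w = v' i].
    by apply/seteqP; split => w /= H i it; rewrite H// /v' ltn_eqF.
  have -> : B = X t @^-1` [set v' t] by rewrite /v' eqxx.
  exact: cyl_indep.
Qed.

End trials.

(** * The law of the runs and the streak *)

Section law.
Context {d : measure_display} {T : measurableType d} {R : realType}.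
Context {P : probability T R} {p : R} {X : nat -> {RV P >-> bool}} {k : nat}.
Hypotheses (p0 : 0 < p) (p1 : p < 1) (k0 : (0 < k)%N).
Hypothesis HX : bernoulli_trials p X.

Definition in_state t j s : set T :=
  [set w | (nb_runs k (X^~ w) t == j) && (streak k (X^~ w) t == s)].

Lemma measurable_in_state t j s : measurable (in_state t j s).
Proof.
apply: (@measurable_prefix _ _ _ _ _
  (fun x => (nb_runs k x t == j) && (streak k x t == s)) t).
by move=> x y xy; rewrite (@nb_runs_prefix k x y)// (@streak_prefix k x y).
Qed.

Definition state_prob t j s : R := fine (P (in_state t j s)).

Lemma state_probE t j s : P (in_state t j s) = (state_prob t j s)%:E.
Proof. by rewrite fineK// fin_num_measure//; exact: measurable_in_state. Qed.

Lemma in_state_trial t j s b : P (in_state t j s `&` X t @^-1` [set b]) =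
  ((if b then p else 1 - p) * state_prob t j s)%:E.
Proof.
rewrite (@prefix_indep _ _ _ _ _ _ p0 p1 HX
  (fun x => (nb_runs k x t == j) && (streak k x t == s)) t).
  by rewrite state_probE -EFinM mulrC.
by move=> x y xy; rewrite (@nb_runs_prefix k x y)// (@streak_prefix k x y).
Qed.

Lemma nb_runs_trial t j b :
  P ([set w | nb_runs k (X^~ w) t == j] `&` X t @^-1` [set b]) =
  ((if b then p else 1 - p) * \sum_(s < k) state_prob t j s)%:E.
Proof.
rewrite (_ : _ `&` _ =
    \big[setU/set0]_(s < k) (in_state t j s `&` X t @^-1` [set b])); last first.
  rewrite -(bigcup_mkord _ (fun s => in_state t j s `&` X t @^-1` [set b])).
  apply/seteqP; split => w /=.
    move=> [nj Xb]; exists (streak k (X^~ w) t); first exact: streak_lt.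
    by rewrite /in_state /= nj eqxx.
  by move=> [s _ [/andP[]]].
rewrite measure_bigsetU_ord.
- by rewrite mulr_sumr -sumEFin; apply: eq_bigr => s _; exact: in_state_trial.
- move=> s; apply: measurableI; first exact: measurable_in_state.
  exact: measurable_trial.
- move=> s s' _ _ [w [[/andP[_ /eqP ss] _] [/andP[_ /eqP ss'] _]]].
  by apply: val_inj; rewrite /= -ss -ss'.
Qed.

(** The events on both sides of each transition are compared outcome by outcome;
    the next trial is independent of the state after t trials. *)
Lemma state_prob_law : run_chain_law p k state_prob.
Proof.
split => [t j s|t j s tjs|j s|t j s sk|t j].
- exact: fine_ge0.
- rewrite /state_prob (_ : in_state t j s = set0) ?measure0//.
  apply/seteqP; split => w //= /andP[/eqP nj /eqP ns].
  by have := nb_runs_streak_le k (X^~ w) t k0; rewrite nj ns leqNgt tjs.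
- rewrite /state_prob.
  have -> : in_state 0 j s = [set w | (j == 0%N) && (s == 0%N)].
    by apply/seteqP; split => w; rewrite /in_state /= /nb_runs big_ord0
      ![_ == 0%N]eq_sym.
  case: (_ && _).
    by rewrite (_ : mkset _ = setT) ?probability_setT//; apply/seteqP; split.
  by rewrite (_ : mkset _ = set0) ?measure0//; apply/seteqP; split.
- apply: EFin_inj; rewrite -state_probE -(in_state_trial t j s true); congr (P _).
  apply/seteqP; split => w; rewrite /in_state /= state_streakS//.
    by move=> /andP[].
  by move=> [-> ->].
- apply: EFin_inj; rewrite -state_probE.
  pose A : set T :=
    if j is j'.+1 then in_state t j' k.-1 `&` X t @^-1` [set true] else set0.
  rewrite (_ : in_state _ _ _ = A `|`
     ([set w | nb_runs k (X^~ w) t == j] `&` X t @^-1` [set false])).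
    rewrite measureU.
    + rewrite EFinD /A; congr (_ + _)%E; last exact: nb_runs_trial.
      case: j {A} => [|j]; first by rewrite measure0.
      exact: in_state_trial.
    + rewrite /A; case: j {A} => // j.
      by apply: measurableI; [exact: measurable_in_state|exact: measurable_trial].
    + apply: measurableI; last exact: measurable_trial.
      apply: (@measurable_prefix _ _ _ _ _ (fun x => nb_runs k x t == j) t).
      by move=> x y xy; rewrite (@nb_runs_prefix k x y).
    + apply/seteqP; split => w //=; rewrite {}/A; case: j => [|j'] [] //.
      by move=> [_ /= ->] [].
  apply/seteqP; split => w; rewrite /in_state /= state_streak0// /A.
    case/orP; last by move=> /andP[nj /negbTE]; right.
    by case: (j) => [|j'] //= /andP[H ?]; left.
  move=> [|[-> /= ->]]; last by rewrite orbT.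
  by case: (j) => [|j'] // [/= -> ->].
Qed.

End law.

Arguments in_state {d T R P} X k t j s.
Arguments state_prob {d T R P} X k t j s.

(** * The waiting time *)

(** For k and r positive: the trial of index t + 1 completes the r-th run. *)
Definition completion (k r : nat) (x : nat -> bool) (t : nat) : bool :=
  [&& nb_runs k x t == r.-1, streak k x t == k.-1 & x t].

Lemma nb_runs_mono k x m n : (m <= n)%N -> (nb_runs k x m <= nb_runs k x n)%N.
Proof.
move=> /subnKC <-; elim: (n - m)%N => [|i IH]; first by rewrite addn0.
by rewrite addnS nb_runsS; apply: leq_trans IH (leq_addr _ _).
Qed.

Lemma completion_nb_runs k r x t : (0 < k)%N -> (0 < r)%N ->
  completion k r x t = (nb_runs k x t < r)%N && (r <= nb_runs k x t.+1)%N.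
Proof.
move=> k0 r0; rewrite nb_runsS /run_completed /completion.
rewrite -[k in _.+1 == k](prednK k0) eqSS.
by case: (x t); case: (streak k x t =P k.-1) => _ /=; rewrite ?andbF ?andbT; lia.
Qed.

Lemma waiting_time_completion {R : realType} k r x t :
  (0 < k)%N -> (0 < r)%N -> completion k r x t ->
  waiting_time R k r x = t.+1%:R%:E.
Proof.
move=> k0 r0; rewrite completion_nb_runs// => /andP[lt_r le_r].
apply/eqP; rewrite eq_le; apply/andP; split.
  by apply: ereal_inf_lbound; exists t.+1.
apply: le_ereal_inf_tmp => _ [n /= rn <-]; rewrite lee_fin ler_nat ltnNge.
apply/negP => nt; have := leq_trans rn (nb_runs_mono k x _ _ nt).
by rewrite leqNgt lt_r.
Qed.

Lemma waiting_time_pinfty {R : realType} k r x :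
  (0 < k)%N -> (0 < r)%N -> (forall t, ~~ completion k r x t) ->
  waiting_time R k r x = +oo%E.
Proof.
move=> k0 r0 nc; apply/ereal_inf_pinfty => _ [n /= rn <-].
exfalso; apply/negP: rn; rewrite -ltnNge; elim: n => [|n IH].
  by rewrite /nb_runs big_ord0.
by have := nc n; rewrite completion_nb_runs// IH /= -ltnNge.
Qed.

Lemma completion_inj k r x t t' : (0 < k)%N -> (0 < r)%N ->
  completion k r x t -> completion k r x t' -> t = t'.
Proof.
move=> k0 r0; rewrite !completion_nb_runs// => /andP[a b] /andP[a' b'].
case: (ltngtP t t') => // tt'.
- by have := leq_trans b (nb_runs_mono k x _ _ tt'); rewrite leqNgt a'.
- by have := leq_trans b' (nb_runs_mono k x _ _ tt'); rewrite leqNgt a.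
Qed.

(** For a < n both sides vanish, on the left because of the factor a - a. *)
Lemma effact_nat {R : realType} (a n : nat) :
  effact (a%:R%:E : \bar R) n = (a ^_ n)%:R%:E.
Proof.
rewrite /effact; elim: n => [|n IH]; first by rewrite big_ord0 ffactn0.
rewrite big_ord_recr /= IH ffactnSr natrM EFinM.
have [na|an] := leqP n a; first by rewrite natrB.
by rewrite ffact_small// !mul0e.
Qed.

Lemma effact_pinfty {R : realType} n : (0 < n)%N ->
  effact (+oo%E : \bar R) n = +oo%E.
Proof.
case: n => // n _; rewrite /effact; elim: n => [|n IH].
  by rewrite big_ord_recl big_ord0 mule1.
by rewrite big_ord_recr /= IH.
Qed.

(** The hypotheses make f measurable: it is constant on each piece of a countable
    measurable partition of the space. The piece where f is +oo is negligible. *)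
Lemma integral_partition {d : measure_display} {T : measurableType d}
    {R : realType} (P : probability T R) (E : nat -> set T) (c : nat -> R)
    (f : T -> \bar R) :
  (forall t, measurable (E t)) -> trivIset setT E ->
  P (\bigcup_t E t) = 1%E -> (forall t, 0 <= c t) ->
  (forall t w, E t w -> f w = (c t)%:E) ->
  (forall w, (forall t, ~ E t w) -> f w = +oo%E) ->
  (\int[P]_w f w = \sum_(t <oo) (c t)%:E * P (E t))%E.
Proof.
move=> mE tE PE c0 fE foo.
pose D := \bigcup_t E t.
have mD : measurable D by exact: bigcup_measurable.
have fC : {in ~` D, cst +oo%E =1 f}.
  by move=> w; rewrite inE /= => nD; rewrite foo// => t Et; apply: nD; exists t.
have fE' t : {in E t, cst (c t)%:E =1 f}.
  by move=> w; rewrite inE /= => /fE.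
have mfD : measurable_fun D f.
  apply/measurable_fun_bigcup => // t.
  exact: (eq_measurable_fun (cst (c t)%:E)).
have mfC : measurable_fun (~` D) f.
  exact: (eq_measurable_fun (cst +oo%E)).
have f0 w : (0 <= f w)%E.
  have [[t _ Et]|nD] := pselect (D w); first by rewrite (fE t)// lee_fin.
  by rewrite foo// => t Et; apply: nD; exists t.
rewrite -(setUv D) ge0_integral_setU//=.
- have -> : (\int[P]_(w in ~` D) f w = 0)%E.
    rewrite -(eq_integral _ _ fC) integral_cst; last exact: measurableC.
    have PC : P (~` D) = 0%E by rewrite probability_setC// PE subee.
    by transitivity (+oo * 0 : \bar R)%E; [congr (_ * _)%E|rewrite mule0].
  rewrite adde0 ge0_integral_bigcup//; apply: eq_eseriesr => t _.
  by rewrite -(eq_integral _ _ (fE' t)) integral_cst.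
- exact: measurableC.
- by apply/measurable_funU => //; exact: measurableC.
- by rewrite disj_set2E; apply/eqP; rewrite setICr.
Qed.

(** * Factorial moments *)

Section moments.
Import numFieldNormedType.Exports.
Context {d : measure_display} {T : measurableType d} {R : realType}.
Context {P : probability T R} {p : R} {X : nat -> {RV P >-> bool}} {k r : nat}.
Hypotheses (p0 : 0 < p) (p1 : p < 1) (k0 : (0 < k)%N) (r0 : (0 < r)%N).
Hypothesis HX : bernoulli_trials p X.

Definition completion_event t : set T := [set w | completion k r (X^~ w) t].

Lemma completion_eventE t :
  completion_event t = in_state X k t r.-1 k.-1 `&` X t @^-1` [set true].
Proof.
apply/seteqP; split => w; rewrite /completion_event /in_state /= /completion.
  by move=> /and3P[-> -> ->].
by move=> [/andP[-> ->] ->].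
Qed.

Lemma measurable_completion_event t : measurable (completion_event t).
Proof.
rewrite completion_eventE.
by apply: measurableI; [exact: measurable_in_state|exact: measurable_trial].
Qed.

Lemma trivIset_completion_event : trivIset setT completion_event.
Proof. by move=> t t' _ _ [w [/= h h']]; exact: completion_inj h h'. Qed.

Lemma completion_prob t :
  P (completion_event t) = (p * state_prob X k t r.-1 k.-1)%:E.
Proof. by rewrite completion_eventE (in_state_trial p0 p1 HX _ _ _ true). Qed.

Let h := occ_coef p k (state_prob X k).

(** On the completion at trial t + 1, Z = t + 1 - r k = t - (r - 1) k - (k - 1)
    is the number of trials spent in failed attempts when the last trial of the
    run starts. *)
Lemma completion_series n :
  (\sum_(t <oo) ((t.+1 - r * k) ^_ n)%:R%:E * P (completion_event t) =
   (n`!%:R * h r n)%:E)%E.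
Proof.
have law := state_prob_law p0 p1 k0 HX.
apply: cvg_lim => //.
rewrite [X in X @ _ --> _](_ : _ = EFin \o (fun N =>
    n`!%:R * (p * occ k (state_prob X k) N r.-1 k.-1 n))).
  apply: cvg_EFin; first exact: nearW.
  apply: cvgMl_tmp; rewrite /h -(prednK r0) /=.
  have -> : p ^+ k = p * p ^+ k.-1 by rewrite -exprS prednK.
  rewrite -mulrA; apply: cvgMl_tmp.
  by apply: (cvg_occ k0 p0 p1 law); rewrite prednK.
apply/funext => N /=; rewrite big_mkord /occ 2!mulr_sumr -sumEFin.
apply: eq_bigr => t _; rewrite [P _]completion_prob -EFinM; congr EFin.
rewrite (_ : t.+1 - r * k = t - r.-1 * k - k.-1)%N; last first.
  rewrite -[in LHS](prednK r0) mulSn; case: (k) k0 => // k' _ /=; lia.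
by rewrite -bin_ffact natrM; ring.
Qed.

Lemma completion_coef0 : h r 0 = 1.
Proof.
have law := state_prob_law p0 p1 k0 HX.
elim: r => // j IH; by rewrite /h (occ_coefS k0 p0 p1 law) big_ord0 addr0.
Qed.

(** The r-th run is almost surely completed: this is [completion_series] for the
    moment of order 0. *)
Lemma completion_mass : P (\bigcup_t completion_event t) = 1%E.
Proof.
rewrite measure_semi_bigcup.
- have := completion_series 0; rewrite fact0 mul1r completion_coef0 => <-.
  by apply: eq_eseriesr => t _; rewrite ffactn0 mul1e.
- exact: measurable_completion_event.
- exact: trivIset_completion_event.
- by apply: bigcup_measurable => t _; exact: measurable_completion_event.
Qed.

Lemma factorial_moment n : (0 < n)%N ->
  (\int[P]_w effact (waiting_time R k r (X^~ w) - (r * k)%:R%:E) n =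
   (n`!%:R * h r n)%:E)%E.
Proof.
move=> n0; rewrite -completion_series; apply: integral_partition.
- exact: measurable_completion_event.
- exact: trivIset_completion_event.
- exact: completion_mass.
- by move=> t; exact: ler0n.
- move=> t w /= ct; rewrite (waiting_time_completion _ _ _ _ k0 r0 ct).
  have /and3P[/eqP nr /eqP sk _] := ct.
  have := nb_runs_streak_le k (X^~ w) t k0; rewrite nr sk => rkt.
  have rkt1 : (r * k <= t.+1)%N.
    rewrite -(prednK r0) mulSn; move: rkt; case: (k) k0 => // k' _ /=; lia.
  by rewrite -EFinB -natrB// effact_nat.
- move=> w nc; rewrite waiting_time_pinfty ?effact_pinfty//.
  by move=> t; apply/negP => ct; exact: (nc t).
Qed.

End moments.

Theorem mainTheorem3 (d : measure_display) (T : measurableType d)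
    (R : realType) (P : probability T R) (p : R) (k r : nat)
    (X : nat -> {RV P >-> bool}) :
  (0 < k)%N -> (0 < r)%N -> 0 < p -> p < 1 ->
  bernoulli_trials p X ->
  let Y : T -> \bar R := fun w => waiting_time R k r (fun t => X t w) in
  let Z : T -> \bar R := fun w => (Y w - (r * k)%:R%:E)%E in
  forall n : nat, (0 < n)%N ->
  (\int[P]_w effact (Z w) n)%E =
  (n`!%:R *
   \sum_(m : {ffun 'I_k -> 'I_n.+1} | (\sum_(j < k) j.+1 * m j == n)%N)
     ((r + \sum_(j < k) m j - 1) ^_ (\sum_(j < k) m j))%N%:R *
     \prod_(j < k) (((m j)`!%:R)^-1 * (momentC p k j.+1 / (j.+1)`!%:R) ^+ m j))%:E.
Proof.
move=> k0 r0 p0 p1 HX Y Z n n0.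
rewrite /Z /Y (factorial_moment p0 p1 k0 r0 HX n n0).
rewrite (occ_coef_negpow k0 p0 p1 (state_prob_law p0 p1 k0 HX) n r n (leqnn n)).
congr (_ * _)%:E; apply: eq_bigr => m _; congr (_ * _); apply: eq_bigr => j _.
by rewrite momentC_runcoef.
Qed.
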